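(* Let $\lambda>0$ and consider $(\mathfrak g_4,S_1^\lambda,J)$. For a real number $c$, the identity $\operatorname{Ric}^0=c\operatorname{Id}+D$ holds for some derivation $D$ of $\mathfrak g_4$ (that is, $(\mathfrak g_4,S_1^\lambda,J)$ is a first kind algebraic Ricci soliton associated to $\nabla^0$ with constant $c$) if and only if $c=0$ and $\lambda=\frac13$. In that case $\operatorname{Ric}^0=D$ is represented in the basis $\{v_1,v_2,v_3,v_4\}$ by $$\begin{bmatrix}-\frac13&0&0&0\\0&\frac13&0&0\\0&0&\frac23&\frac23\\0&0&0&0\end{bmatrix}.$$
   Context: $\mathfrak g_4$ is the real Lie algebra with basis $e_1,e_2,e_3,e_4$ and non-zero brackets (up to skew-symmetry) $[e_1,e_2]=e_3$, $[e_1,e_3]=e_4$. For $\lambda>0$, $S_1^\lambda$ is the Lorentzian inner product $\langle\cdot,\cdot\rangle$ on $\mathfrak g_4$ whose matrix in $(e_1,e_2,e_3,e_4)$ is $\begin{bmatrix}1&0&0&0\\0&0&0&1\\0&0&\lambda&0\\0&1&0&0\end{bmatrix}$. Fix the basis $v_1=e_1$, $v_2=\frac1{\sqrt\lambda}e_3$, $v_3=\frac1{\sqrt2}(e_2+e_4)$, $v_4=\frac1{\sqrt2}(e_2-e_4)$, which is orthonormal: $\langle v_i,v_j\rangle=0$ for $i\ne j$, $\langle v_i,v_i\rangle=1$ for $i=1,2,3$, $\langle v_4,v_4\rangle=-1$. The product structure $J$ is the linear map with $Jv_i=v_i$ for $i=1,2,3$ and $Jv_4=-v_4$. Write $\mathfrak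 g$ for the Lie algebra. The Levi-Civita connection is the bilinear map $\nabla:\mathfrak g\times\mathfrak g\to\mathfrak g$ with $2\langle\nabla_uv,w\rangle=\langle[u,v],w\rangle+\langle[w,u],v\rangle+\langle[w,v],u\rangle$ for all $u,v,w$. Put $(\nabla_uJ)v=\nabla_u(Jv)-J(\nabla_uv)$. The canonical connection is $\nabla^0_uv=\nabla_uv-\frac12(\nabla_uJ)Jv$. Its curvature is $R^0_{uv}w=\nabla^0_{[u,v]}w-\nabla^0_u\nabla^0_vw+\nabla^0_v\nabla^0_uw$, and its Ricci operator is $\operatorname{Ric}^0(u)=\sum_{k=1}^4\langle v_k,v_k\rangle R^0_{v_ku}v_k$. A derivation of $\mathfrak g$ is a linear map $D:\mathfrak g\to\mathfrak g$ with $[D(u),v]+[u,D(v)]=D[u,v]$ for all $u,v\in\mathfrak g$. In matrices, the $j$-th column contains the coordinates of the image of $v_j$ in the basis $(v_1,v_2,v_3,v_4)$. *)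

(* Defs.v *)
From HB Require Import structures.
From mathcomp Require Import all_boot all_order all_algebra.
From mathcomp Require Import reals.
From mathcomp Require Import ring.

Set Implicit Arguments.
Unset Strict Implicit.
Unset Printing Implicit Defensive.

Import Order.TTheory GRing.Theory Num.Theory.
Local Open Scope ring_scope.

Section Generic.
Context {R : realType} {V : lmodType R}.
Implicit Types (br : V -> V -> V) (g : V -> V -> R) (D J : V -> V).

Definition derivation br D : Prop :=
  forall u v, br (D u) v + br u (D v) = D (br u v).

Definition orthonormal_frame g n (eps : 'I_n -> R) (v : 'I_n -> V) : Prop :=
  forall i j, g (v i) (v j) = if i == j then eps i else 0.

Definition levi_civita br g (nabla : V -> V -> V) : Prop :=
  forall u v w,
    2 * g (nabla u v) w = g (br u v) w + g (br w u) v + g (br w v) u.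

Definition covariant_deriv (nabla : V -> V -> V) J (u v : V) : V :=
  nabla u (J v) - J (nabla u v).

Definition canonical_connection (nabla : V -> V -> V) J (u v : V) : V :=
  nabla u v - 2^-1 *: covariant_deriv nabla J u (J v).

Definition curvature br (nabla : V -> V -> V) (u v w : V) : V :=
  nabla (br u v) w - nabla u (nabla v w) + nabla v (nabla u w).

Definition ricci_op g n (v : 'I_n -> V) (Rm : V -> V -> V -> V) (u : V) : V :=
  \sum_k g (v k) (v k) *: Rm (v k) u (v k).

Definition soliton_derivation br (Ric : V -> V) (c : R) D : Prop :=
  derivation br D /\ forall u, Ric u = c *: u + D u.

Definition first_kind_soliton br (Ric : V -> V) (c : R) : Prop :=
  exists D : {linear V -> V}, soliton_derivation br Ric c D.

(* column j of M holds the coordinates of f (v j) *)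
Definition represented_by n (v : 'I_n -> V) (f : V -> V) (M : 'M[R]_n) : Prop :=
  forall j, f (v j) = \sum_i M i j *: v i.

End Generic.

Definition mx4 {R : realType} (rows : seq (seq R)) : 'M[R]_4 :=
  \matrix_(i, j) ((nth [::] rows i)`_j).

(* g_4 is modelled on column vectors of coordinates in (e_1, ..., e_4).
   Indices start at 0: e_(i+1) is [basis_e i], v_(i+1) is [frame_v lambda i]. *)
Notation g4 R := 'cV[R]_4.

Section G4.
Context {R : realType}.
Implicit Types (lambda : R) (u w x : g4 R).

Definition basis_e (i : 'I_4) : g4 R := delta_mx i 0.

Definition bracket u w : g4 R :=
  (u 0 0 * w 1 0 - u 1 0 * w 0 0) *: basis_e 2 +
  (u 0 0 * w 2 0 - u 2 0 * w 0 0) *: basis_e 3.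

Definition S1_mx lambda : 'M[R]_4 :=
  mx4 [:: [:: 1; 0; 0; 0];
          [:: 0; 0; 0; 1];
          [:: 0; 0; lambda; 0];
          [:: 0; 1; 0; 0]].

Definition S1 lambda u w : R := (u^T *m S1_mx lambda *m w) 0 0.

Definition frame_v lambda (i : 'I_4) : g4 R :=
  [:: basis_e 0;
      (Num.sqrt lambda)^-1 *: basis_e 2;
      (Num.sqrt 2)^-1 *: (basis_e 1 + basis_e 3);
      (Num.sqrt 2)^-1 *: (basis_e 1 - basis_e 3)]`_i.

Definition frame_sign (i : 'I_4) : R := [:: 1; 1; 1; -1]`_i.

Definition product_structure lambda (J : g4 R -> g4 R) : Prop :=
  forall i, J (frame_v lambda i) = frame_sign i *: frame_v lambda i.

Lemma g4P u w :
  u 0 0 = w 0 0 -> u 1 0 = w 1 0 -> u 2 0 = w 2 0 -> u 3 0 = w 3 0 -> u = w.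
Proof.
move=> h0 h1 h2 h3; apply/colP => i.
have : [\/ i = 0, i = 1, i = 2 | i = 3].
  by case: i => -[|[|[|[|//]]]] ?;
    [constructor 1|constructor 2|constructor 3|constructor 4]; exact: val_inj.
by case=> ->.
Qed.

Lemma S1E lambda u w :
  S1 lambda u w = u 0 0 * w 0 0 + u 1 0 * w 3 0 + u 3 0 * w 1 0
                  + lambda * (u 2 0 * w 2 0).
Proof.
have E f : \sum_(i < 4) f i = f 0 + f 1 + f 2 + f 3 :> R.
  rewrite !big_ord_recl big_ord0 addr0 !addrA.
  by congr (f _ + f _ + f _ + f _); exact: val_inj.
by rewrite /S1 !mxE E !mxE !E !mxE /=; ring.
Qed.

Lemma bracket_bilinear : bilinear_for *:%R *:%R (bracket : g4 R -> g4 R -> g4 R).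
Proof.
by split=> w a u x; apply: g4P; rewrite !mxE /=; ring.
Qed.

Lemma bracket_alternating u : bracket u u = 0.
Proof. by apply: g4P; rewrite !mxE /=; ring. Qed.

Lemma bracket_jacobi u w x :
  bracket u (bracket w x) + bracket w (bracket x u) + bracket x (bracket u w) = 0.
Proof. by apply: g4P; rewrite !mxE /=; ring. Qed.

Lemma bracket_basis :
  [/\ bracket (basis_e 0) (basis_e 1) = basis_e 2,
      bracket (basis_e 0) (basis_e 2) = basis_e 3,
      bracket (basis_e 0) (basis_e 3) = 0
    & forall i j, i != 0 -> j != 0 -> bracket (basis_e i) (basis_e j) = 0].
Proof.
split; try by apply: g4P; rewrite !mxE /=; ring.
move=> i j i0 j0; apply: g4P; rewrite !mxE [0 == i]eq_sym [0 == j]eq_sym.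
all: by rewrite (negPf i0) (negPf j0) !(mul0r, mulr0, subr0, oppr0, addr0).
Qed.

Lemma frame_v_orthonormal lambda : 0 < lambda ->
  orthonormal_frame (S1 lambda) frame_sign (frame_v lambda).
Proof.
move=> l0; have l2 := sqr_sqrtr (ltW l0).
have s0 : Num.sqrt lambda != 0 by rewrite gt_eqF ?sqrtr_gt0.
have t2 : Num.sqrt 2 ^+ 2 = 2 :> R by rewrite sqr_sqrtr.
have t0 : Num.sqrt 2 != 0 :> R by rewrite gt_eqF ?sqrtr_gt0.
have halves : (Num.sqrt 2)^-1 * (Num.sqrt 2)^-1 = 2^-1 :> R.
  by rewrite -invfM -expr2 t2.
have invl : lambda * ((Num.sqrt lambda)^-1 * (Num.sqrt lambda)^-1) = 1.
  by rewrite -{1}l2; field.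
case=> -[|[|[|[|//]]]] ? [] [|[|[|[|//]]]] ?;
  rewrite S1E !mxE /frame_sign /= ?eqE /=
          ?(mulr1, mulr0, mul0r, addr0, add0r, subr0, sub0r, mulrN, mulNr, opprK);
  rewrite ?halves ?invl //; by [ring | field].
Qed.

Definition nabla4 lambda u w : g4 R :=
  \col_i [:: 2^-1 * ((1 + lambda) * (u 2 0 * w 1 0 + u 1 0 * w 2 0));
             0;
             2^-1 * (u 0 0 * w 1 0 - u 1 0 * w 0 0
                     - lambda^-1 * (u 0 0 * w 1 0 + u 1 0 * w 0 0));
             2^-1 * (u 0 0 * w 2 0 - u 2 0 * w 0 0
                     - lambda * (u 0 0 * w 2 0 + u 2 0 * w 0 0))]`_i.

Lemma nabla4_bilinear lambda : bilinear_for *:%R *:%R (nabla4 lambda).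
Proof. by split=> w a u x; apply: g4P; rewrite !mxE /=; ring. Qed.

Lemma levi_civita_exists lambda : 0 < lambda ->
  exists nabla : {bilinear g4 R -> g4 R -> g4 R},
    levi_civita bracket (S1 lambda) nabla.
Proof.
move=> l0; have ln0 : lambda != 0 by rewrite gt_eqF.
pose f := bilinear_isBilinear.Build R (g4 R) (g4 R) (g4 R) *:%R *:%R
  (nabla4 lambda) (nabla4_bilinear lambda).
pose nabla : {bilinear g4 R -> g4 R -> g4 R} := HB.pack (nabla4 lambda) f.
exists nabla => u w x; rewrite !S1E /= !mxE /=; field; exact: ln0.
Qed.

Lemma levi_civita_unique lambda (nabla nabla' : g4 R -> g4 R -> g4 R) :
  0 < lambda ->
  levi_civita bracket (S1 lambda) nabla ->
  levi_civita bracket (S1 lambda) nabla' -> nabla =2 nabla'.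
Proof.
move=> l0 h h' u w.
have n2 : 2 != 0 :> R by rewrite pnatr_eq0.
have H x : S1 lambda (nabla u w) x = S1 lambda (nabla' u w) x.
  by apply: (mulfI n2); rewrite h h'.
have := (H (basis_e 0), H (basis_e 1), H (basis_e 2), H (basis_e 3)).
rewrite !S1E !mxE /= !(mulr1, mulr0, addr0, add0r) => -[[[h0 h3] h2] h1].
by apply: g4P => //; apply: (mulfI (lt0r_neq0 l0)).
Qed.

Definition J4 u : g4 R :=
  \col_i [:: u 0 0; u 3 0; u 2 0; u 1 0]`_i.

Lemma product_structure_exists lambda :
  exists J : {linear g4 R -> g4 R}, product_structure lambda J.
Proof.
have J4_linear : linear J4.
  by move=> a u w; apply: g4P; rewrite !mxE.
pose f := GRing.isLinear.Build R (g4 R) (g4 R) *:%R J4 J4_linear.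
pose J : {linear g4 R -> g4 R} := HB.pack J4 f.
exists J; case=> -[|[|[|[|//]]]] ?;
  apply: g4P; rewrite /= !mxE /frame_sign /=; ring.
Qed.

Lemma product_structure_unique lambda (J J' : {linear g4 R -> g4 R}) :
  0 < lambda ->
  product_structure lambda J -> product_structure lambda J' -> J =1 J'.
Proof.
move=> l0 h h' u.
have s0 : Num.sqrt lambda != 0 by rewrite gt_eqF ?sqrtr_gt0.
have t0 : Num.sqrt 2 != 0 :> R by rewrite gt_eqF ?sqrtr_gt0.
have -> : u = u 0 0 *: frame_v lambda 0
    + (Num.sqrt lambda * u 2 0) *: frame_v lambda 1
    + (Num.sqrt 2 / 2 * (u 1 0 + u 3 0)) *: frame_v lambda 2
    + (Num.sqrt 2 / 2 * (u 1 0 - u 3 0)) *: frame_v lambda 3.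
  by apply: g4P; rewrite !mxE /=; field; rewrite ?s0 ?t0.
rewrite !linearD; congr (_ + _ + _ + _).
all: rewrite [LHS]linearZ [RHS]linearZ /=; congr (_ *: _).
all: by apply: etrans (h _) (esym (h' _)).
Qed.

End G4.

(* Main.v *)
From HB Require Import structures.
Require Import Defs.
From mathcomp Require Import all_boot all_order all_algebra.
From mathcomp Require Import reals.
From mathcomp Require Import ring lra.
Import Order.TTheory GRing.Theory Num.Theory.
Local Open Scope ring_scope.

(** In the basis [e_i] the Ricci operator of the canonical connection sends [u]
    to [(- a u_1, r u_2, a u_3, r u_2)], where [a = (1 + lambda) / 4] and
    [r = a (1 - lambda) / lambda]. Testing the derivation identity for
    [Ric0 - c Id] on [(e_1, e_3)] forces [c = 0], and on [(e_1, e_2)] it then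
    forces [r = 2 a], that is [lambda = 1 / 3]. *)

Section CanonicalRicci.
Context {R : realType}.
Implicit Types (lambda : R) (u w : g4 R).

(** Up to scale, [v_3] and [v_4] are the sum and difference of [e_2] and [e_4], so reversing [v_4]
    swaps these two coordinates. *)
Lemma product_structure_coord lambda (J : {linear g4 R -> g4 R}) :
  0 < lambda -> product_structure lambda J -> J =1 J4.
Proof.
move=> l0 hJ.
have J4_linear : linear (@J4 R) by move=> a u w; apply: g4P; rewrite !mxE.
pose f := GRing.isLinear.Build R (g4 R) (g4 R) *:%R J4 J4_linear.
pose J' : {linear g4 R -> g4 R} := HB.pack (@J4 R) f.
apply: (@product_structure_unique _ lambda J J') => //.
by case=> -[|[|[|[|//]]]] ?; apply: g4P; rewrite /= !mxE /frame_sign /=; ring.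
Qed.

Lemma levi_civita_nabla4 lambda : 0 < lambda ->
  levi_civita bracket (S1 lambda) (nabla4 lambda).
Proof.
move=> l0 u w x; have ln0 : lambda != 0 by rewrite gt_eqF.
by rewrite !S1E /= !mxE /=; field.
Qed.

(** For [lambda > 0] this connection is metric and commutes with [J]. It therefore kills the line of
    [v_4], which leaves only the sum [w_2 + w_4], and takes values in the +1 eigenspace of [J],
    whence the repeated entry [p]. *)
Definition connection0 lambda u w : g4 R :=
  let p := ((1 - lambda) * u 0 0 * w 2 0 - (1 + lambda) * u 2 0 * w 0 0) / 4 in
  \col_i [:: (1 + lambda) / 4 *
               (u 2 0 * (w 1 0 + w 3 0) + 2 * (u 1 0 * w 2 0));
             p;
             ((1 - lambda^-1) * u 0 0 * (w 1 0 + w 3 0)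
              - 2 * ((1 + lambda^-1) * u 1 0 * w 0 0)) / 4;
             p]`_i.

(** Skew-symmetry in [u] and [w] leaves only the minors [o i j]. Index 3 is absent from them because
    [e_4] is central and the connection vanishes in its direction. *)
Definition curvature0 lambda u w (x : g4 R) : g4 R :=
  let a := (1 + lambda) / 4 in
  let o i j := u i 0 * w j 0 - u j 0 * w i 0 in
  let q := a * (((lambda^-1 - 1) / 2 - 1) * o 0 1 * x 0 0
                - 2 * a * o 1 2 * x 2 0) in
  \col_i [:: a / 2 * ((3 - lambda^-1) * o 0 1 * (x 1 0 + x 3 0)
                      + (1 - lambda) * o 0 2 * x 2 0);
             q;
             a / 2 * ((1 - lambda^-1) * o 0 2 * x 0 0
                      + (1 + lambda^-1) * o 1 2 * (x 1 0 + x 3 0));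
             q]`_i.

Definition ricci0 lambda u : g4 R :=
  let a := (1 + lambda) / 4 in
  let r := a * (1 - lambda) / lambda in
  \col_i [:: - a * u 0 0; r * u 1 0; a * u 2 0; r * u 1 0]`_i.

Lemma canonical_connectionE lambda (nabla : g4 R -> g4 R -> g4 R)
    (J : {linear g4 R -> g4 R}) :
  0 < lambda -> product_structure lambda J ->
  levi_civita bracket (S1 lambda) nabla ->
  canonical_connection nabla J =2 connection0 lambda.
Proof.
move=> l0 hJ hn u w; have ln0 : lambda != 0 by rewrite gt_eqF.
have nE := levi_civita_unique l0 hn (levi_civita_nabla4 _ l0).
rewrite /canonical_connection /covariant_deriv !nE.
rewrite !(product_structure_coord _ _ l0 hJ).
by apply: g4P; rewrite !mxE /=; field.
Qed.

Lemma curvature0E lambda u w x : lambda != 0 ->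
  curvature bracket (connection0 lambda) u w x = curvature0 lambda u w x.
Proof.
move=> ln0; rewrite /curvature; apply: g4P.
all: by rewrite !mxE /=; field.
Qed.

Lemma ricci_opE lambda (nabla : g4 R -> g4 R -> g4 R)
    (J : {linear g4 R -> g4 R}) u :
  0 < lambda -> product_structure lambda J ->
  levi_civita bracket (S1 lambda) nabla ->
  ricci_op (S1 lambda) (frame_v lambda)
    (curvature bracket (canonical_connection nabla J)) u = ricci0 lambda u.
Proof.
move=> l0 hJ hn; have ln0 : lambda != 0 by rewrite gt_eqF.
have cE := canonical_connectionE _ _ _ l0 hJ hn.
have s2 : (Num.sqrt lambda)^-1 ^+ 2 = lambda^-1.
  by rewrite exprVn sqr_sqrtr // ltW.
have t2 : (Num.sqrt 2)^-1 ^+ 2 = 2^-1 :> R by rewrite exprVn sqr_sqrtr.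
rewrite /ricci_op !big_ord_recl big_ord0.
have curvE x y z :
    curvature bracket (canonical_connection nabla J) x y z =
    curvature0 lambda x y z.
  by rewrite -curvature0E // /curvature !cE.
rewrite !(frame_v_orthonormal l0) !eqxx !curvE /frame_v /frame_sign /=.
(* With [s] and [t] abstract, the frame vectors are polynomial in them, and [s2], [t2] are the only
   relations kept. *)
move: s2 t2; move: (Num.sqrt lambda)^-1 (Num.sqrt 2)^-1 => s t s2 t2.
pose a := (1 + lambda) / 4.
(* Only even powers of the two square roots survive the sum over the frame; in
   this form they can be rewritten away before calling [field]. *)
transitivity (let q := a * (((lambda^-1 - 1) / 2 - 1) * u 1 0
                            + 2 * a * u 1 0 * s ^+ 2) in
  \col_i [:: - (a / 2 * ((1 - lambda) * s ^+ 2
                         + 2 * (3 - lambda^-1) * t ^+ 2) * u 0 0);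
             q;
             a / 2 * (1 - lambda^-1 + 2 * (1 + lambda^-1) * t ^+ 2) * u 2 0;
             q]`_i : g4 R).
  by apply: g4P; rewrite !mxE /=; rewrite /a; ring.
by rewrite s2 t2; apply: g4P; rewrite !mxE /= /a; field.
Qed.

Lemma ricci0_linear lambda : linear (ricci0 lambda).
Proof. by move=> a u w; apply: g4P; rewrite !mxE /=; ring. Qed.

Lemma ricci0_soliton_const lambda c (D : g4 R -> g4 R) : 0 < lambda ->
  soliton_derivation bracket (ricci0 lambda) c D -> c = 0 /\ lambda = 1 / 3.
Proof.
move=> l0 [derD hD]; have ln0 : lambda != 0 by rewrite gt_eqF.
have DE u : D u = ricci0 lambda u - c *: u by rewrite hD addrC addKr.
have c0 : c = 0.
  (* The eigenvalues [- a - c] on [e_1] and [a - c] on [e_3] add up to [- 2 c], while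
     [D e_4 = - c e_4]. *)
  have /colP/(_ 3) := derD (basis_e 0) (basis_e 2).
  by rewrite !DE !mxE /=; lra.
split=> //.
have /colP/(_ 2) := derD (basis_e 0) (basis_e 1).
rewrite !DE c0 !mxE /= => h.
(* The left side is [r - 2 a] in factored form; its first factor is positive. *)
have : (1 + lambda) / (4 * lambda) * (1 - 3 * lambda) = 0.
  move/eqP: h; rewrite -subr_eq0 => /eqP <-; field; exact: ln0.
have /mulfI inj : (1 + lambda) / (4 * lambda) != 0.
  by rewrite gt_eqF // divr_gt0 ?addr_gt0 ?mulr_gt0.
by rewrite -[RHS](mulr0 ((1 + lambda) / (4 * lambda))) => /inj; lra.
Qed.

(** Here [a = 1/3] and [r = 2/3]: the weights of [e_1], [e_2], [e_3] are -1/3, 2/3, 1/3, and [e_4]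
    goes to 0, so they add up along both brackets. The extra [e_4] term in the image of [e_2] is
    central. *)
Lemma ricci0_derivation : derivation bracket (ricci0 (1 / 3)).
Proof. by move=> u w; apply: g4P; rewrite !mxE /=; field. Qed.

Lemma ricci0_represented :
  represented_by (frame_v (1 / 3)) (ricci0 (1 / 3))
    (mx4 [:: [:: - (1 / 3); 0;     0;     0];
             [:: 0;         1 / 3; 0;     0];
             [:: 0;         0;     2 / 3; 2 / 3];
             [:: 0;         0;     0;     0]]).
Proof.
(* Each frame vector and its image carry matching factors, so the identity holds for arbitrary [s]
   and [t]. Both [v_3] and [v_4] have [e_2] coordinate [t], hence the same image. *)
rewrite /frame_v; move: (Num.sqrt _)^-1 (Num.sqrt _)^-1 => s t.
by case=> -[|[|[|[|//]]]] ?; rewrite !big_ord_recl big_ord0; apply: g4P;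
  rewrite /frame_v !mxE /=; field.
Qed.

End CanonicalRicci.

Theorem theorem3p3 (R : realType) (lambda : R) (hlambda : 0 < lambda)
    (J : {linear g4 R -> g4 R}) (hJ : product_structure lambda J)
    (nabla : {bilinear g4 R -> g4 R -> g4 R})
    (hnabla : levi_civita bracket (S1 lambda) nabla) (c : R) :
  let Ric0 := ricci_op (S1 lambda) (frame_v lambda)
                (curvature bracket (canonical_connection nabla J)) in
  (first_kind_soliton bracket Ric0 c <-> c = 0 /\ lambda = 1 / 3) /\
  (forall D : {linear g4 R -> g4 R},
     soliton_derivation bracket Ric0 c D ->
     (forall u, Ric0 u = D u) /\
     represented_by (frame_v lambda) Ric0
       (mx4 [:: [:: - (1 / 3); 0;     0;     0];
                [:: 0;         1 / 3; 0;     0];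
                [:: 0;         0;     2 / 3; 2 / 3];
                [:: 0;         0;     0;     0]])).
Proof.
move=> Ric0.
have RicE u : Ric0 u = ricci0 lambda u by exact: ricci_opE.
have const (D : {linear g4 R -> g4 R}) :
    soliton_derivation bracket Ric0 c D -> c = 0 /\ lambda = 1 / 3.
  case=> derD hD; apply: (ricci0_soliton_const _ _ D) => //.
  by split=> // u; rewrite -RicE.
split; first split.
- by case=> D /const.
- case=> c0 l3.
  (* Since [c = 0], the witness must be the Ricci operator itself. *)
  pose f := GRing.isLinear.Build R (g4 R) (g4 R) *:%R _ (ricci0_linear lambda).
  pose D : {linear g4 R -> g4 R} := HB.pack (ricci0 lambda) f.
  exists D; split; first by rewrite /= l3; exact: ricci0_derivation.
  by move=> u; rewrite c0 scale0r add0r RicE.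
- move=> D hD; have [c0 l3] := const D hD; split=> [u|j].
    by rewrite hD.2 c0 scale0r add0r.
  by rewrite RicE l3; exact: ricci0_represented.
Qed.
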